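(* There is an arithmetic term $T_2$ in one variable such that for every composite number $n$, the value $T_2(n)$ is equal to the greatest non-trivial divisor of $n$, and for every prime number $p$, $T_2(p) = 1$.
   Context: $\mathbb{N}$ includes $0$. Arithmetic terms are the expressions, interpreted as functions on $\mathbb{N}$, defined inductively: the constants $0$, $1$ and the variables are arithmetic terms; if $t_1, t_2$ are arithmetic terms, then so are $(t_1 + t_2)$, $(t_1 \mathbin{\dot{-}} t_2)$, $(t_1 * t_2)$, $(t_1 / t_2)$ and $2^{t_1}$. Here $a \mathbin{\dot{-}} b = \max(a-b, 0)$ and $a/b = \lfloor a/b \rfloor$ is the quotient of integer division, with $a/0 := 0$. A non-trivial divisor of $n$ is a divisor $d$ with $1 < d < n$. A natural number $n$ is composite if $n>1$ and $n$ is not prime. *)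

(* Defs.v *)
From mathcomp Require Import all_boot.

Set Implicit Arguments.
Unset Strict Implicit.
Unset Printing Implicit Defensive.

Inductive arith_term (k : nat) : Type :=
  | AZero
  | AOne
  | AVar of 'I_k
  | AAdd of arith_term k & arith_term k
  | ASub of arith_term k & arith_term k
  | AMul of arith_term k & arith_term k
  | ADiv of arith_term k & arith_term k
  | AExp2 of arith_term k.

(* subn is truncated subtraction, and divn satisfies m %/ 0 = 0. *)
Fixpoint aeval (k : nat) (t : arith_term k) (v : 'I_k -> nat) : nat :=
  match t with
  | AZero => 0
  | AOne => 1
  | AVar i => v i
  | AAdd t1 t2 => aeval t1 v + aeval t2 v
  | ASub t1 t2 => aeval t1 v - aeval t2 v
  | AMul t1 t2 => aeval t1 v * aeval t2 v
  | ADiv t1 t2 => aeval t1 v %/ aeval t2 v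
  | AExp2 t1 => 2 ^ aeval t1 v
  end.

Definition aeval1 (t : arith_term 1) (n : nat) : nat := aeval t (fun=> n).

Definition composite (n : nat) : bool := (1 < n) && ~~ prime n.

Definition nontrivial_divisor (d n : nat) : bool := (d %| n) && (1 < d < n).

Definition greatest_nontrivial_divisor (d n : nat) : Prop :=
  nontrivial_divisor d n /\ (forall e : nat, nontrivial_divisor e n -> e <= d).

(* Main.v *)
(** Let p be the least prime factor of n > 1; the term computes n / p.  Put
    R = 2^n.  For a >= 2 the equation (R^a - 1) (y + 1) = R^a (R^n - 1) has a
    solution y iff a divides n, and then y + 1 = R^a + R^(2a) + ... + R^n.  So
    the sum W of y + 1 over all solutions (a, y) with a >= 2 is R^p times an
    odd number, and p = v_2(W) / n.

    The sum W is obtained by counting carries.  One packs the pairs (a, y) in a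
    box into consecutive blocks of bits of a number X, the block of (a, y)
    holding a flag bit, set iff a linear inequality in y with coefficients
    exponential in a holds, followed by a run of y ones.  If M has a single one
    at each flag position, then adding M to X produces y + 1 carries in each
    flagged block, so v_2(C(X + M, M)) is the sum of y + 1 over the solutions of
    the inequality (Kummer); the equation is the difference of two
    inequalities.  X is a combination of sums of q^x and x q^x with q a power of
    2, hence given by a term.

    Terms for binomial coefficients and gcds come from reading one digit, in a
    large base B, of (B + 1)^n and of a product of two geometric sums.
    Finally v_2(x) is recovered from 2^v = gcd(x, 2^x) because
    (m + 1)^v = 1 + v m modulo m^2. *)

Require Import Defs.
From mathcomp Require Import all_boot.
From mathcomp Require Import zify.

(** * Closure of term-definable functions under arithmetic *)

(* Small n are irrelevant, and excluding them removes the degenerate cases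
   (empty geometric sums, gcd with 0) from the closure lemmas. *)
Definition definable (f : nat -> nat) : Prop :=
  exists t : arith_term 1, forall n, 1 < n -> aeval1 t n = f n.

Lemma eq_definable f g :
  (forall n, 1 < n -> f n = g n) -> definable f -> definable g.
Proof. by move=> fg [t ft]; exists t => n n1; rewrite ft // fg. Qed.

Lemma definable_id : definable (fun n => n).
Proof. by exists (AVar ord0). Qed.

Lemma definableD f g :
  definable f -> definable g -> definable (fun n => f n + g n).
Proof.
by move=> [t ft] [r gr]; exists (AAdd t r) => n n1; rewrite -ft // -gr.
Qed.

Lemma definableB f g :
  definable f -> definable g -> definable (fun n => f n - g n).
Proof.
by move=> [t ft] [r gr]; exists (ASub t r) => n n1; rewrite -ft // -gr.
Qed.

Lemma definableM f g :
  definable f -> definable g -> definable (fun n => f n * g n).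
Proof.
by move=> [t ft] [r gr]; exists (AMul t r) => n n1; rewrite -ft // -gr.
Qed.

Lemma definable_div f g :
  definable f -> definable g -> definable (fun n => f n %/ g n).
Proof.
by move=> [t ft] [r gr]; exists (ADiv t r) => n n1; rewrite -ft // -gr.
Qed.

Lemma definable_exp2 f : definable f -> definable (fun n => 2 ^ f n).
Proof. by move=> [t ft]; exists (AExp2 t) => n n1; rewrite -ft. Qed.

Lemma definable_const k : definable (fun=> k).
Proof.
elim: k => [|k [t tk]]; first by exists (AZero 1).
by exists (AAdd (AOne 1) t) => n n1; have := tk n n1; rewrite /aeval1 /= => ->.
Qed.

Lemma definable_mod f g :
  definable f -> definable g -> definable (fun n => f n %% g n).
Proof.
move=> df dg; apply: (@eq_definable (fun n => f n - f n %/ g n * g n)).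
  by move=> n _; rewrite {1}(divn_eq (f n) (g n)) addKn.
by apply: definableB => //; apply: definableM => //; apply: definable_div.
Qed.

(* Modulo 2^w - x one has 2^w = x, and 2^w - x exceeds x^k for this w. *)
Lemma expn_mod_exp2 x k :
  let w := x * k + x + 1 in x ^ k = (2 ^ w) ^ k %% (2 ^ w - x).
Proof.
move=> w; have xw : x ^ k + x < 2 ^ w.
  have x2 : x < 2 ^ x by apply: ltn_expl.
  have xk2 : x ^ k <= 2 ^ (x * k) by rewrite expnM; case: k {w} => // k; rewrite leq_exp2r // ltnW.
  have k1 : 0 < 2 ^ (x * k) by rewrite expn_gt0.
  rewrite /w !expnD; move: (2 ^ (x * k)) (2 ^ x) (x ^ k) x2 xk2 k1 => p q r; nia.
have xw' : x <= 2 ^ w by lia.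
have -> : (2 ^ w) ^ k = x ^ k %[mod 2 ^ w - x].
  by rewrite -{1}(subnK xw') -modnXm modnDl modnXm.
by rewrite modn_small // ltn_subRL addnC.
Qed.

Lemma definableX f g :
  definable f -> definable g -> definable (fun n => f n ^ g n).
Proof.
move=> df dg; pose w n := f n * g n + f n + 1.
apply: (@eq_definable (fun n => 2 ^ (w n * g n) %% (2 ^ w n - f n))).
  by move=> n _; rewrite [RHS]expn_mod_exp2 expnM.
have dw : definable w.
  apply: definableD; last exact: definable_const.
  by apply: definableD => //; apply: definableM.
apply: definable_mod; first by apply/definable_exp2/definableM.
by apply: definableB => //; apply: definable_exp2.
Qed.

(** * Digit extraction and geometric sums *)

(** The coefficients add up to less than [B], so collecting equal exponents yields the true base-[B]
    expansion, without carries. *)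
Lemma sum_expn_coef (I : finType) (c e : I -> nat) B E :
  \sum_i c i < B ->
  (\sum_i c i * B ^ e i) %/ B ^ E %% B = \sum_(i | e i == E) c i.
Proof.
move=> cB; have B0 : 0 < B by apply: leq_trans cB.
have split3 : \sum_i c i * B ^ e i =
    B ^ E * (B * \sum_(i | E < e i) c i * B ^ (e i - E.+1)
             + \sum_(i | e i == E) c i) + \sum_(i | e i < E) c i * B ^ e i.
  rewrite (bigID (fun i => e i < E)) /= addnC; congr (_ + _).
  rewrite (bigID (fun i => e i == E)) /= addnC mulnDr mulnA -expnSr !big_distrr /=.
  congr (_ + _).
    apply: eq_big => [i|i /andP[]]; first by lia.
    rewrite -leqNgt leq_eqVlt eq_sym => /orP[/eqP->|lt _]; first by rewrite eqxx.
    by rewrite mulnCA -expnD subnKC.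
  by apply: eq_big => [i|i /andP[_ /eqP->]]; [lia | rewrite mulnC].
have low : \sum_(i | e i < E) c i * B ^ e i < B ^ E.
  case: E {split3} => [|E]; first by rewrite big_pred0.
  apply: (@leq_ltn_trans ((\sum_i c i) * B ^ E)).
    rewrite big_distrl /= [leqRHS](bigID (fun i => e i < E.+1)) /=.
    apply: leq_trans (leq_addr _ _); apply: leq_sum => i lt.
    by rewrite leq_mul2l leq_pexp2l ?orbT.
  by rewrite expnS ltn_pmul2r // expn_gt0 B0.
rewrite split3 mulnC divnMDl ?expn_gt0 ?B0 // divn_small // addn0.
rewrite mulnC modnMDl modn_small //; apply: leq_ltn_trans cB.
by rewrite [leqRHS](bigID (fun i => e i == E)) leq_addr.
Qed.

Lemma sum_expn q t : 1 < q -> \sum_(i < t) q ^ i = (q ^ t - 1) %/ (q - 1).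
Proof. by move=> q1; rewrite !subn1 predn_exp mulKn // -subn1 subn_gt0. Qed.

Lemma sum_mul_expn q t : 1 < q ->
  \sum_(i < t) i * q ^ i = (t * q ^ t - q * \sum_(i < t) q ^ i) %/ (q - 1).
Proof.
move=> q1; have telescope :
    (q - 1) * \sum_(i < t) i * q ^ i + q * \sum_(i < t) q ^ i = t * q ^ t.
  case: q q1 => // q _; rewrite subSS subn0.
  elim: t => [|t IH]; first by rewrite !big_ord0 !muln0.
  rewrite !big_ord_recr /= expnS.
  by move: (\sum_(i < t) _) (\sum_(i < t) _) (_ ^ t) IH => S0 S1 p; nia.
by rewrite -telescope addnK mulKn // subn_gt0.
Qed.

Lemma definable_sum_exp2 t k : definable t -> definable k ->
  (forall n, 1 < n -> 0 < k n) ->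
  definable (fun n => \sum_(x < t n) 2 ^ (k n * x)).
Proof.
move=> dt dk k0.
apply: (@eq_definable (fun n => (2 ^ (k n * t n) - 1) %/ (2 ^ k n - 1))).
  move=> n /k0 kn; under [RHS]eq_bigr => i _ do rewrite expnM.
  by rewrite sum_expn -?expnM // -{1}(expn0 2) ltn_exp2l.
apply: definable_div; apply: definableB; try exact: definable_const.
  by apply/definable_exp2/definableM.
exact: definable_exp2.
Qed.

Lemma definable_sum_mul_exp2 t k : definable t -> definable k ->
  (forall n, 1 < n -> 0 < k n) ->
  definable (fun n => \sum_(x < t n) x * 2 ^ (k n * x)).
Proof.
move=> dt dk k0.
apply: (@eq_definable (fun n =>
    (t n * 2 ^ (k n * t n) - 2 ^ k n * \sum_(x < t n) 2 ^ (k n * x))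
      %/ (2 ^ k n - 1))).
  move=> n /k0 kn; under eq_bigr => i _ do rewrite expnM.
  under [RHS]eq_bigr => i _ do rewrite expnM.
  by rewrite sum_mul_expn -?expnM // -{1}(expn0 2) ltn_exp2l.
apply: definable_div; apply: definableB.
- by apply: definableM => //; apply/definable_exp2/definableM.
- by apply: definableM; [apply: definable_exp2 | apply: definable_sum_exp2].
- exact: definable_exp2.
- exact: definable_const.
Qed.

(** * Greatest common divisors and 2-adic valuations *)

(** With [g] the gcd, [b %| a * i.+1] amounts to [b %/ g %| i.+1], and [1, ..., b] contains exactly
    [g] multiples of [b %/ g]. *)
Lemma sum_dvdn_mul a b : 0 < a -> 0 < b ->
  \sum_(i < b) (b %| a * i.+1) = gcdn a b.
Proof.
move=> a0 b0; set g := gcdn a b; have g0 : 0 < g by rewrite gcdn_gt0 a0.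
have ea : a = a %/ g * g by rewrite divnK // dvdn_gcdl.
have eb : b = b %/ g * g by rewrite divnK // dvdn_gcdr.
have cop : coprime (b %/ g) (a %/ g).
  by rewrite /coprime -(eqn_pmul2r g0) muln_gcdl -ea -eb gcdnC mul1n.
have b'0 : 0 < b %/ g by rewrite divn_gt0 // dvdn_leq // dvdn_gcdr.
under eq_bigr => i _ do
  rewrite {1}eb {1}ea mulnAC dvdn_pmul2r // Gauss_dvdr //.
have := divn_count_dvd (b %/ g) b.
rewrite big_add1 big_mkord /= => <-.
by rewrite {1}eb mulKn.
Qed.

(** In base [B = 2 ^ (a * b)] the product is a sum of [a * b < B] powers with exponents
    [a * i.+1 + b * j]. The exponent [a * b] occurs once for each [i] with [b %| a * i.+1], since
    [j] is then determined. *)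
Lemma gcdn_coef a b : 0 < a -> 0 < b ->
  gcdn a b = ((2 ^ (a * b)) ^ a * (\sum_(i < b) 2 ^ (a * b * a * i))
    * (\sum_(j < a) 2 ^ (a * b * b * j))) %/ (2 ^ (a * b)) ^ (a * b)
    %% 2 ^ (a * b).
Proof.
move=> a0 b0; pose B := 2 ^ (a * b).
have -> : (2 ^ (a * b)) ^ a * (\sum_(i < b) 2 ^ (a * b * a * i))
    * (\sum_(j < a) 2 ^ (a * b * b * j)) =
    \sum_(p : 'I_b * 'I_a) 1 * B ^ (a * p.1.+1 + b * p.2).
  rewrite -(pair_bigA _ (fun (i : 'I_b) (j : 'I_a) =>
    1 * B ^ (a * i.+1 + b * j))) /=.
  rewrite -mulnA big_distrl big_distrr /=; apply: eq_bigr => i _.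
  rewrite !big_distrr /=; apply: eq_bigr => j _.
  by rewrite mul1n -!expnM -!expnD; congr (_ ^ _); lia.
rewrite sum_expn_coef; last first.
  by rewrite sum1_card card_prod !card_ord mulnC ltn_expl.
rewrite -(pair_big_dep xpredT (fun (i : 'I_b) (j : 'I_a) =>
  a * i.+1 + b * j == a * b) (fun _ _ => 1)) /=.
rewrite -sum_dvdn_mul //; apply: eq_bigr => i _.
have le_ab : a * i.+1 <= a * b by rewrite leq_mul2l ltn_ord orbT.
case: (boolP (b %| a * i.+1)) => [/dvdnP[k ek] | nd].
  have k_le : k <= a by rewrite -(leq_pmul2r b0) -ek.
  (* Using [i.+1] rather than [i] forces [k > 0], so that [a - k] is a valid index. *)
  have k0 : 0 < k by case: k ek {k_le} => // /eqP; rewrite muln_eq0; lia.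
  have lt : a - k < a by lia.
  rewrite (big_pred1 (Ordinal lt)) // => j.
  rewrite ek /= -val_eqE /= (mulnC k) -mulnDr (mulnC a b) eqn_pmul2l //; lia.
rewrite big_pred0 // => j; apply: contraNF nd => /eqP e.
by rewrite -(dvdn_addl _ (dvdn_mulr j (dvdnn b))) e dvdn_mull.
Qed.

Lemma definable_gcd f g : definable f -> definable g ->
  (forall n, 1 < n -> 0 < f n) -> (forall n, 1 < n -> 0 < g n) ->
  definable (fun n => gcdn (f n) (g n)).
Proof.
move=> df dg f0 g0.
apply: eq_definable; first by move=> n n1; rewrite [RHS]gcdn_coef ?f0 ?g0.
have dfg : definable (fun n => f n * g n) by apply: definableM.
have dB : definable (fun n => 2 ^ (f n * g n)) by apply: definable_exp2.
apply: definable_mod => //; apply: definable_div; last exact: definableX.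
apply: definableM.
  apply: definableM; first exact: definableX.
  apply: (@definable_sum_exp2 g (fun n => f n * g n * f n)) => //.
    exact: definableM.
  by move=> n n1; rewrite !muln_gt0 f0 // g0.
apply: (@definable_sum_exp2 f (fun n => f n * g n * g n)) => //.
  exact: definableM.
by move=> n n1; rewrite !muln_gt0 f0 // g0.
Qed.

Lemma gcdn_exp2 x : 0 < x -> gcdn x (2 ^ x) = 2 ^ logn 2 x.
Proof.
move=> x0; have [//|m odd_m ex] := @pfactor_coprime 2 x _ x0.
have vx : logn 2 x <= x by apply: ltnW; apply: ltn_logl.
rewrite {1}ex -{2}(subnK vx) expnD -muln_gcdl.
by rewrite (eqP (coprimeXr _ _)) ?mul1n // coprime_sym.
Qed.

Lemma expn_modn_sqr v m : 1 < m -> v < m -> m.+1 ^ v %% m ^ 2 %/ m = v.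
Proof.
move=> m1 vm; have -> : m.+1 ^ v = 1 + v * m %[mod m ^ 2].
  elim: v {vm} => [|v IH]; first by rewrite mul0n.
  rewrite expnS -modnMmr IH modnMmr -[RHS](modnMDl v).
  by congr (_ %% _); rewrite -mulnn; lia.
rewrite modn_small; last by rewrite -mulnn; nia.
by rewrite addnC divnMDl ?divn_small ?addn0 //; lia.
Qed.

Lemma definable_logn2 f : definable f -> (forall n, 1 < n -> 0 < f n) ->
  definable (fun n => logn 2 (f n)).
Proof.
(* With [m = 2 ^ k n - 1] and [v] the valuation, [(2 ^ v) ^ k n] is [m.+1 ^ v]; this [k] makes [m]
   exceed both 1 and [v]. *)
move=> df f0; pose k n := f n + 2.
apply: (@eq_definable (fun n =>
  gcdn (f n) (2 ^ f n) ^ k n %% (2 ^ k n - 1) ^ 2 %/ (2 ^ k n - 1))).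
  move=> n n1; rewrite gcdn_exp2 ?f0 // -expnM mulnC expnM.
  have kn : k n < 2 ^ k n by apply: ltn_expl.
  have vf : logn 2 (f n) < f n by apply: ltn_logl; rewrite ?f0.
  have {1}-> : 2 ^ k n = (2 ^ k n - 1).+1 by rewrite subn1 prednK ?expn_gt0.
  by rewrite expn_modn_sqr //; rewrite /k in kn *; lia.
have dk : definable (fun n => 2 ^ k n).
  by apply/definable_exp2/definableD => //; apply: definable_const.
have dk1 : definable (fun n => 2 ^ k n - 1).
  by apply: definableB => //; apply: definable_const.
apply: definable_div => //; apply: definable_mod.
  apply: definableX; last by apply: definableD => //; apply: definable_const.
  by apply: definable_gcd => // [|n _]; [apply: definable_exp2 | rewrite expn_gt0].
by apply: definableX => //; apply: definable_const.
Qed.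

(** * Binomial coefficients as digits *)

Lemma bin_coef n k :
  'C(n, k) = (2 ^ n.+1 + 1) ^ n %/ (2 ^ n.+1) ^ k %% 2 ^ n.+1.
Proof.
have sumC : \sum_(i < n.+1) 'C(n, i) = 2 ^ n.
  by rewrite -[2]/(1 + 1) expnDn; apply: eq_bigr => i _; rewrite !exp1n !muln1.
rewrite addnC expnDn.
under eq_bigr => i _ do rewrite exp1n mul1n.
rewrite sum_expn_coef ?sumC ?ltn_exp2l //.
case: (leqP k n) => [kn|nk].
  by rewrite (big_pred1 (inord k)) ?inordK // => i /=; rewrite -val_eqE /= inordK.
rewrite bin_small // big_pred0 // => i; have := ltn_ord i; lia.
Qed.

Lemma definable_bin f g :
  definable f -> definable g -> definable (fun n => 'C(f n, g n)).
Proof.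
move=> df dg; apply: eq_definable; first by move=> n _; rewrite [RHS]bin_coef.
have dB : definable (fun n => 2 ^ (f n).+1).
  apply: (@eq_definable (fun n => 2 ^ (f n + 1))) => [n _|]; first by rewrite addn1.
  by apply/definable_exp2/definableD => //; apply: definable_const.
apply: definable_mod => //; apply: definable_div; last exact: definableX.
by apply: definableX => //; apply: definableD => //; apply: definable_const.
Qed.

(** * Carries and the 2-adic valuation of binomial coefficients *)

(** Odd factors contribute nothing, and the even ones are the doubles of [1, ..., n]. *)
Lemma logn2_fact_half n b : b < 2 ->
  logn 2 (b + 2 * n)`! = n + logn 2 n`!.
Proof.
have odd_step m : logn 2 (1 + 2 * m)`! = logn 2 (2 * m)`!.
  by rewrite add1n factS lognM ?fact_gt0 // lognE dvdn2 /= mul2n odd_double.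
have even_case : logn 2 (2 * n)`! = n + logn 2 n`!.
  elim: n => [|n IH]; first by [].
  have -> : 2 * n.+1 = (1 + 2 * n).+1 by lia.
  rewrite factS lognM ?fact_gt0 // odd_step IH.
  have -> : (1 + 2 * n).+1 = 2 * n.+1 by lia.
  rewrite lognM // logn_prime // eqxx factS lognM ?fact_gt0 //; lia.
by case: b => [|[|]] // _; rewrite ?odd_step // add0n.
Qed.

(** Each halving contributes the current quotient (Legendre's formula). The share of [X] at halving
    [i] is [2 ^ (s - i) * X], in total [(2 ^ s - 1) * X]. *)
Lemma logn2_fact_split s x X : x < 2 ^ s ->
  logn 2 (x + 2 ^ s * X)`! = logn 2 x`! + (2 ^ s - 1) * X + logn 2 X`!.
Proof.
elim: s x => [|s IH] x.
  by rewrite expn0 ltnS leqn0 => /eqP->; rewrite fact0 logn1 mul1n subnn mul0n.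
rewrite expnS => x2s; have xe : x = x %% 2 + 2 * (x %/ 2) by lia.
have half : x %/ 2 < 2 ^ s by lia.
have -> : x + 2 * 2 ^ s * X = x %% 2 + 2 * (x %/ 2 + 2 ^ s * X) by lia.
rewrite {3}xe !logn2_fact_half ?ltn_pmod // IH //.
have p0 : 0 < 2 ^ s by rewrite expn_gt0.
by move: (2 ^ s) p0 => p p0 {IH xe x2s half}; nia.
Qed.

(* By Kummer's theorem the valuation counts the carries of x + m, and no carry
   crosses bit s when x + m < 2^s. *)
Lemma logn2_bin_split s x m X M : x + m < 2 ^ s ->
  logn 2 'C((x + 2 ^ s * X) + (m + 2 ^ s * M), m + 2 ^ s * M)
  = logn 2 'C(x + m, m) + logn 2 'C(X + M, M).
Proof.
move=> xm.
have logn2_bin y z :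
    logn 2 (y + z)`! = logn 2 'C(y + z, z) + logn 2 z`! + logn 2 y`!.
  rewrite -(bin_fact (leq_addl y z)) addnK mulnA.
  by rewrite !lognM ?muln_gt0 ?fact_gt0 ?bin_gt0 ?leq_addl.
have := logn2_bin (x + 2 ^ s * X) (m + 2 ^ s * M).
have -> : x + 2 ^ s * X + (m + 2 ^ s * M) = (x + m) + 2 ^ s * (X + M) by lia.
rewrite !logn2_fact_split; try lia.
have := logn2_bin x m; have := logn2_bin X M.
by move: (2 ^ s) => p; nia.
Qed.

Lemma sum_exp2_lt s N (x : nat -> nat) : (forall i, i < N -> x i < 2 ^ s) ->
  \sum_(i < N) 2 ^ (s * i) * x i < 2 ^ (s * N).
Proof.
elim: N => [|N IH] xs; first by rewrite big_ord0 muln0.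
rewrite big_ord_recr /= mulnS addnC expnD.
have := IH (fun i iN => xs i (ltnW iN)); have := xs N (ltnSn N).
by move: (\sum_(i < N) _) (2 ^ (s * N)) (2 ^ s) (x N) => S p q y; nia.
Qed.

(** Digits that do not overflow send no carry upwards, so [logn2_bin_split] can peel off the lowest
    one repeatedly. *)
Lemma logn2_bin_sum s N (x m : nat -> nat) :
  (forall i, i < N -> x i + m i < 2 ^ s) ->
  logn 2 'C(\sum_(i < N) 2 ^ (s * i) * x i + \sum_(i < N) 2 ^ (s * i) * m i,
            \sum_(i < N) 2 ^ (s * i) * m i)
  = \sum_(i < N) logn 2 'C(x i + m i, m i).
Proof.
elim: N x m => [|N IH] x m xms; first by rewrite !big_ord0 bin0 logn1.
have shift (y : nat -> nat) : \sum_(i < N.+1) 2 ^ (s * i) * y i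
    = y 0 + 2 ^ s * \sum_(i < N) 2 ^ (s * i) * y i.+1.
  rewrite big_ord_recl /= muln0 mul1n big_distrr /=; congr (_ + _).
  by apply: eq_bigr => i _; rewrite mulnA -expnD -mulnS.
rewrite !shift logn2_bin_split ?xms //.
rewrite big_ord_recl /= -(IH (fun i => x i.+1) (fun i => m i.+1)) // => i iN.
exact: xms.
Qed.

(* The digit carries a flag at bit u, set iff th <= E, followed by a run of l
   ones; adding 2^u propagates a carry through the run iff the flag is set. *)
Lemma logn2_bin_flag u l E th : E < 2 ^ u -> th <= 2 ^ u ->
  logn 2 'C(E + 2 ^ u + 2 ^ u.+1 * 2 ^ l - (th + 2 ^ u.+1) + 2 ^ u, 2 ^ u)
  = if th <= E then l.+1 else 0.
Proof.
move=> Eu thu; have l0 : 0 < 2 ^ l by rewrite expn_gt0.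
have key g y : g < 2 ^ u ->
    logn 2 'C(g + 2 ^ u * y + 2 ^ u, 2 ^ u) = logn 2 y.+1.
  move=> gu; have := @logn2_bin_split u g 0 y 1.
  by rewrite addn0 muln1 bin0 logn1 addn1 bin1 !add0n => ->.
case: leqP => thE.
  have -> : E + 2 ^ u + 2 ^ u.+1 * 2 ^ l - (th + 2 ^ u.+1)
      = (E - th) + 2 ^ u * (2 ^ l.+1 - 1).
    by rewrite !expnS; move: (2 ^ u) (2 ^ l) l0 Eu thu => p q; nia.
  rewrite key; last by lia.
  by rewrite subn1 prednK ?expn_gt0 // pfactorK.
(* When [E < th] the subtraction borrows the flag bit; the part from bit [u] on is then even, its
   successor odd. *)
have -> : E + 2 ^ u + 2 ^ u.+1 * 2 ^ l - (th + 2 ^ u.+1)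
    = (E + 2 ^ u - th) + 2 ^ u * (2 * (2 ^ l - 1)).
  by rewrite !expnS; move: (2 ^ u) (2 ^ l) l0 Eu thu => p q; nia.
rewrite key; last by lia.
by rewrite lognE dvdn2 /= mul2n odd_double.
Qed.

(** * Solutions of the equation and divisors of [n] *)

(** Modulo [q ^ a - 1], [q ^ n] agrees with [q ^ (n %% a)]; hence [q ^ (n %% a) - 1] is a multiple
    of a larger number, so it is 0. *)
Lemma dvdn_expn_sub1 q a n : 1 < q -> 0 < a -> q ^ a - 1 %| q ^ n - 1 -> a %| n.
Proof.
move=> q1 a0 dvd_n; have qm m : 0 < q ^ m by rewrite expn_gt0 ltnW.
have qa : q ^ a = 1 %[mod q ^ a - 1] by rewrite -{1}(subnK (qm a)) modnDl.
have qn : q ^ n = q ^ (n %% a) %[mod q ^ a - 1].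
  rewrite {1}(divn_eq n a) expnD (mulnC (n %/ a)) expnM -modnMml -modnXm qa.
  by rewrite modnXm exp1n modnMml mul1n.
have lt : q ^ (n %% a) - 1 < q ^ a - 1.
  by rewrite ltn_sub2r -?(expn0 q) ?ltn_exp2l ?ltn_pmod.
have : q ^ (n %% a) - 1 == 0.
  rewrite -(modn_small lt) -/(dvdn _ _) -eqn_mod_dvd // -qn eqn_mod_dvd //.
by rewrite subn_eq0 -(expn0 q) leq_exp2l // leqn0.
Qed.

(* The equation says (q^a - 1) (y + 1) = q^a (q^n - 1). *)
Lemma weight_eq_dvdn q n a y : 1 < q -> 0 < a ->
  q ^ a * (y + 2) = q ^ (a + n) + 1 + y -> a %| n /\ q ^ a %| y.+1.
Proof.
move=> q1 a0; rewrite expnD => eq_y.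
have qm m : 0 < q ^ m by rewrite expn_gt0 ltnW.
have qa := qm a; have qn := qm n.
have eq1 : (q ^ a - 1) * y.+1 = q ^ a * (q ^ n - 1).
  by move: (q ^ a) (q ^ n) qa qn eq_y => A B; nia.
have eq2 : q ^ a * (q ^ n - 1) + y.+1 = q ^ a * y.+1.
  by move: (q ^ a) (q ^ n) qa qn eq_y eq1 => A B; nia.
split.
  apply: (@dvdn_expn_sub1 q) => //.
  have cop : coprime (q ^ a - 1) (q ^ a).
    by rewrite -{2}(subnK qa) addn1 coprimenS.
  by rewrite -(Gauss_dvdr _ cop) -eq1 dvdn_mulr.
by rewrite -(dvdn_addr _ (dvdn_mulr (q ^ n - 1) (dvdnn (q ^ a)))) eq2 dvdn_mulr.
Qed.

(** The only solution is [y.+1 = q ^ a * S], where the geometric sum [S] of ratio [q ^ a] is 1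
    modulo [q]; the bound on [Y] puts it in the box. *)
Lemma weight_dvdn q n a Y : 1 < q -> 0 < n -> 0 < a -> a %| n ->
    q ^ n.+1 <= Y ->
  exists m, \sum_(y < Y) (if q ^ a * (y + 2) == q ^ (a + n) + 1 + y
                          then y.+1 else 0) = q ^ a + q ^ a.+1 * m.
Proof.
move=> q1 n0 a0 /dvdnP[k ek] leY.
have qm m : 0 < q ^ m by rewrite expn_gt0 ltnW.
have k0 : 0 < k by case: k ek n0 => // ->.
have qa1 : 1 < q ^ a by rewrite -(expn0 q) ltn_exp2l.
pose S := \sum_(j < k) (q ^ a) ^ j.
have eS : (q ^ a - 1) * S = q ^ n - 1.
  by rewrite !subn1 -predn_exp -expnM mulnC -ek.
have [m em] : exists m, S = 1 + q * m.
  rewrite /S; case: k k0 {ek S eS} => // k _; rewrite big_ord_recl.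
  exists (q ^ a.-1 * \sum_(i < k) (q ^ a) ^ i).
  rewrite mulnA -expnS prednK // big_distrr /=; congr (_ + _).
  by apply: eq_bigr => i _; rewrite -expnS.
have S0 : 0 < q ^ a * S by rewrite muln_gt0 qm em.
(* Indeed [q ^ a * S = q ^ n - 1 + S] is less than [2 * q ^ n]. *)
have ltY : (q ^ a * S).-1 < Y.
  apply: leq_trans leY; rewrite prednK // expnS.
  have := qm n; move: (q ^ a) (q ^ n) qa1 eS => A B; nia.
have solve y : (q ^ a * (y + 2) == q ^ (a + n) + 1 + y) = (y.+1 == q ^ a * S).
  have AS : q ^ a * S + 1 = q ^ n + S.
    by have := qm n; move: (q ^ a) (q ^ n) qa1 eS => A B; nia.
  rewrite expnD -(@eqn_pmul2l (q ^ a - 1) y.+1); last by lia.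
  have -> : (q ^ a - 1) * (q ^ a * S) = q ^ a * (q ^ n - 1) by rewrite mulnCA eS.
  have := qm n; move: (q ^ a) (q ^ n) qa1 => A B A1 B0.
  by apply/eqP/eqP; nia.
exists m; rewrite (bigD1 (Ordinal ltY)) //= big1 => [|y ne].
  by rewrite addn0 solve prednK // eqxx em mulnDr muln1 mulnA expnSr.
rewrite solve; case: eqP => // e; case/eqP: ne; apply: val_inj => /=.
by rewrite -e.
Qed.

(** The index [pdiv n - 2] gives the leading power; any other divisor in the sum exceeds [pdiv n],
    so its weight is a multiple of [q ^ (pdiv n).+1]. *)
Lemma sum_weight_pdiv q n Y : 1 < q -> 1 < n -> q ^ n.+1 <= Y ->
  exists m, \sum_(a < n) \sum_(y < Y)
      (if q ^ a.+2 * (y + 2) == q ^ (a.+2 + n) + 1 + y then y.+1 else 0)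
    = q ^ pdiv n * (1 + q * m).
Proof.
move=> q1 n1 leY; set p := pdiv n.
have p_pr : prime p by apply: pdiv_prime.
have p2 : 1 < p by apply: prime_gt1.
have pn : p <= n by apply: pdiv_leq; lia.
have lt : p - 2 < n by lia.
rewrite (bigD1 (Ordinal lt)) //=.
have -> : (p - 2).+2 = p by lia.
have [||m ->] := @weight_dvdn q n p Y q1 _ _ (pdiv_dvd n) leY; try lia.
set rest := (X in _ + X).
have /dvdnP[r ->] : q ^ p.+1 %| rest.
  apply: dvdn_sum => a ne; apply: dvdn_sum => y _.
  case: eqP => [e|_]; last exact: dvdn0.
  have [an qay] := @weight_eq_dvdn q n a.+2 y q1 isT e.
  apply: dvdn_trans qay; apply: dvdn_exp2l.
  have : p <= a.+2 by apply: pdiv_min_dvd.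
  by move: ne; rewrite -val_eqE /=; lia.
by exists (m + r); rewrite expnS; nia.
Qed.

(** * Packing the box into one number *)

(* The index a of a block stands for the candidate divisor a + 2.  The
   digit of (a, y) is high - low, kept as a difference of two sums of monomials
   so that both can be summed in closed form; d = 0 and d = 1 give the two
   inequalities whose difference is the equation. *)
Definition range n := 2 ^ (n * n.+1).
(** [2 ^ flag n] is [4 * range n ^ 2], enough to bound both sides of the inequalities over the box;
    [width n] adds room for the longest run of ones. *)
Definition flag n := n * n.+1 * 2 + 2.
Definition width n := flag n + range n + 3.

Definition high n a y :=
  (2 ^ n) ^ a.+2 * (y + 2) + 2 ^ flag n + 2 ^ (flag n).+1 * 2 ^ y.
Definition low d n a y :=
  (2 ^ n) ^ (a.+2 + n) + 1 + y + d + 2 ^ (flag n).+1.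

(** Block [(a, y)] starts at bit [width n * (range n * a + y)]; nesting lets rows be treated as
    digits in turn. *)
Definition pack n (x : nat -> nat -> nat) :=
  \sum_(a < n) 2 ^ (width n * range n * a)
    * \sum_(y < range n) 2 ^ (width n * y) * x a y.

Lemma digit_bounds n a y : a < n -> y < range n ->
  (2 ^ n) ^ a.+2 * (y + 2) < 2 ^ flag n /\
  (2 ^ n) ^ (a.+2 + n) + 1 + y + 1 <= 2 ^ flag n.
Proof.
move=> an yY; have eu : 2 ^ flag n = range n * range n * 4.
  by rewrite /flag expnD expnM -mulnn.
have le1 : (2 ^ n) ^ a.+2 <= range n.
  by rewrite -expnM leq_exp2l // leq_mul2l; lia.
have le2 : (2 ^ n) ^ (a.+2 + n) <= range n * range n.
  by rewrite expnD leq_mul // -expnM leq_exp2l // leq_mul2l leqnSn orbT.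
rewrite eu; move: le1 le2 yY.
by move: (range n) (_ ^ _) (_ ^ _) => Y A B *; split; nia.
Qed.

Lemma low_le_high d n a y : d <= 1 -> a < n -> y < range n ->
  low d n a y <= high n a y.
Proof.
move=> d1 an yY; have [_] := digit_bounds _ _ _ an yY; rewrite /low /high.
have y0 : 0 < 2 ^ y by rewrite expn_gt0.
have := leq_pmulr (2 ^ (flag n).+1) y0; lia.
Qed.

Lemma high_lt n a y : a < n -> y < range n ->
  high n a y + 2 ^ flag n < 2 ^ width n.
Proof.
move=> an yY; have [E2 _] := digit_bounds _ _ _ an yY.
have le : 2 ^ y <= 2 ^ range n by rewrite leq_exp2l // ltnW.
have y0 : 0 < 2 ^ y by rewrite expn_gt0.
rewrite /high /width 2!expnD (expnS 2 (flag n)) (_ : 2 ^ 3 = 8) //; move: E2 le y0.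
move: (_ * (y + 2)) (2 ^ flag n) (2 ^ y) (2 ^ range n) => E F p q EF pq p0.
by have := leq_mul (leqnn F) pq; have := leq_pmulr F p0; nia.
Qed.

(** [logn2_bin_sum] is applied first to rows, then to the blocks of a row, where [logn2_bin_flag]
    takes [l = y]. *)
Lemma logn2_bin_pack d n : d <= 1 ->
  let X := pack n (fun a y => high n a y - low d n a y) in
  let M := pack n (fun _ _ => 2 ^ flag n) in
  logn 2 'C(X + M, M) = \sum_(a < n) \sum_(y < range n)
    (if (2 ^ n) ^ (a.+2 + n) + 1 + y + d <= (2 ^ n) ^ a.+2 * (y + 2)
     then y.+1 else 0).
Proof.
move=> d1 X M.
have lt a y : a < n -> y < range n ->
    high n a y - low d n a y + 2 ^ flag n < 2 ^ width n.
  by move=> an yY; have := high_lt _ _ _ an yY; lia.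
pose row (x : nat -> nat -> nat) (a : nat) :=
  \sum_(y < range n) 2 ^ (width n * y) * x a y.
pose x a y := high n a y - low d n a y; pose m (a y : nat) := 2 ^ flag n.
rewrite [LHS](logn2_bin_sum (width n * range n) n (row x) (row m)); last first.
  move=> a an; rewrite /row -big_split /=.
  under eq_bigr => y _ do rewrite -mulnDr.
  by apply: (@sum_exp2_lt _ _ (fun y => x a y + m a y)) => y; apply: lt.
apply: eq_bigr => a _.
rewrite [LHS](logn2_bin_sum (width n) (range n) (x a) (m a)); last first.
  by move=> y; apply: lt.
apply: eq_bigr => y _; have [E2 th2] := digit_bounds _ _ _ (ltn_ord a) (ltn_ord y).
by rewrite /x /high /low logn2_bin_flag //; lia.
Qed.

(** * Terms for the packed numbers *)

Lemma definable_range : definable range.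
Proof.
apply: (@eq_definable (fun n => 2 ^ (n * (n + 1)))).
  by move=> n _; rewrite addn1.
apply/definable_exp2/definableM; first exact: definable_id.
by apply: definableD; [apply: definable_id | apply: definable_const].
Qed.

Lemma definable_flag : definable flag.
Proof.
apply: (@eq_definable (fun n => n * (n + 1) * 2 + 2)).
  by move=> n _; rewrite addn1.
apply: definableD; last exact: definable_const.
apply: definableM; last exact: definable_const.
apply: definableM; first exact: definable_id.
by apply: definableD; [apply: definable_id | apply: definable_const].
Qed.

Lemma definable_width : definable width.
Proof.
apply: definableD; last exact: definable_const.
by apply: definableD; [apply: definable_flag | apply: definable_range].
Qed.

Lemma width_gt0 n : 0 < width n.
Proof. by rewrite /width; lia. Qed.

Lemma area_gt0 n : 0 < width n * range n.
Proof. by rewrite muln_gt0 width_gt0 expn_gt0. Qed.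

Lemma packD n x z :
  pack n (fun a y => x a y + z a y) = pack n x + pack n z.
Proof.
rewrite /pack -big_split; apply: eq_bigr => a _ /=.
rewrite -mulnDr -big_split; congr (_ * _); apply: eq_bigr => y _ /=.
exact: mulnDr.
Qed.

Lemma eq_pack n x z :
  (forall a y, a < n -> y < range n -> x a y = z a y) -> pack n x = pack n z.
Proof.
move=> xz; apply: eq_bigr => a _; congr (_ * _); apply: eq_bigr => y _.
by rewrite xz.
Qed.

(** A separable digit turns the double sum into a product of two single sums, each with a closed
    form. *)
Lemma pack_prod n c (x z : nat -> nat) :
  pack n (fun a y => c * (x a * z y)) =
  c * ((\sum_(a < n) 2 ^ (width n * range n * a) * x a)
       * \sum_(y < range n) 2 ^ (width n * y) * z y).
Proof.
rewrite big_distrlr big_distrr; apply: eq_bigr => a _ /=.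
rewrite !big_distrr; apply: eq_bigr => y _ /=.
by move: (2 ^ _) (2 ^ _) => p q; lia.
Qed.

Lemma definable_pack_exp2 c i j : definable c -> definable i -> definable j ->
  definable (fun n => pack n (fun a y => c n * (2 ^ (i n * a) * 2 ^ (j n * y)))).
Proof.
move=> dc di dj; have dw := definable_width; have dr := definable_range.
apply: (@eq_definable (fun n =>
    c n * ((\sum_(a < n) 2 ^ ((width n * range n + i n) * a))
           * \sum_(y < range n) 2 ^ ((width n + j n) * y)))).
  move=> n _; rewrite pack_prod; congr (_ * (_ * _)); apply: eq_bigr => x _;
  by rewrite -expnD -mulnDl.
apply: definableM => //; apply: definableM.
  apply: definable_sum_exp2 => [||n _]; first exact: definable_id.
    by apply: definableD => //; apply: definableM.
  by rewrite addn_gt0 area_gt0.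
apply: definable_sum_exp2 => // [|n _]; first exact: definableD.
by rewrite addn_gt0 width_gt0.
Qed.

Lemma definable_pack_mul_exp2 c i : definable c -> definable i ->
  definable (fun n => pack n (fun a y => c n * (2 ^ (i n * a) * y))).
Proof.
move=> dc di; have dw := definable_width; have dr := definable_range.
apply: (@eq_definable (fun n =>
    c n * ((\sum_(a < n) 2 ^ ((width n * range n + i n) * a))
           * \sum_(y < range n) y * 2 ^ (width n * y)))).
  move=> n _; rewrite (pack_prod _ _ _ (fun y => y)).
  congr (_ * (_ * _)); apply: eq_bigr => x _; last by rewrite mulnC.
  by rewrite -expnD -mulnDl.
apply: definableM => //; apply: definableM.
  apply: definable_sum_exp2 => [||n _]; first exact: definable_id.
    by apply: definableD => //; apply: definableM.
  by rewrite addn_gt0 area_gt0.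
by apply: definable_sum_mul_exp2 => // n _; apply: width_gt0.
Qed.

Lemma definable_pack_mask : definable (fun n => pack n (fun _ _ => 2 ^ flag n)).
Proof.
apply: (@eq_definable (fun n =>
    pack n (fun a y => 2 ^ flag n * (2 ^ (0 * a) * 2 ^ (0 * y))))).
  by move=> n _; apply: eq_pack => a y _ _; rewrite !mul0n !muln1.
apply: definable_pack_exp2; try exact: definable_const.
exact/definable_exp2/definable_flag.
Qed.

Lemma definable_pack_high : definable (fun n => pack n (high n)).
Proof.
have dF := definable_flag.
have d2n : definable (fun n => 2 ^ (n * 2)).
  apply/definable_exp2/definableM; first exact: definable_id.
  exact: definable_const.
apply: (@eq_definable (fun n =>
    pack n (fun a y => 2 ^ (n * 2) * (2 ^ (n * a) * y))
    + pack n (fun a y => 2 ^ (n * 2) * 2 * (2 ^ (n * a) * 2 ^ (0 * y)))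
    + pack n (fun a y => 2 ^ flag n * (2 ^ (0 * a) * 2 ^ (0 * y)))
    + pack n (fun a y => 2 ^ (flag n + 1) * (2 ^ (0 * a) * 2 ^ (1 * y))))).
  move=> n _; rewrite -!packD; apply: eq_pack => a y _ _.
  rewrite /high !mul0n !mul1n expn0 !muln1 addn1 -[a.+2]addn2 expnD -!expnM.
  by move: (2 ^ (n * a)) (2 ^ (n * 2)) (_ * 2 ^ y) => p q r; lia.
apply: definableD; first apply: definableD; first apply: definableD.
- by apply: definable_pack_mul_exp2 => //; apply: definable_id.
- apply: definable_pack_exp2; [|exact: definable_id|exact: definable_const].
  by apply: definableM => //; apply: definable_const.
- apply: definable_pack_exp2; try exact: definable_const.
  exact: definable_exp2.
- apply: definable_pack_exp2; try exact: definable_const.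
  by apply/definable_exp2/definableD => //; apply: definable_const.
Qed.

Lemma definable_pack_low d : definable (fun n => pack n (low d n)).
Proof.
have dF := definable_flag; have did := definable_id.
apply: (@eq_definable (fun n =>
    pack n (fun a y => 2 ^ (n * 2 + n * n) * (2 ^ (n * a) * 2 ^ (0 * y)))
    + pack n (fun a y => 1 * (2 ^ (0 * a) * y))
    + pack n (fun a y => (2 ^ (flag n + 1) + (1 + d))
                         * (2 ^ (0 * a) * 2 ^ (0 * y))))).
  move=> n _; rewrite -!packD; apply: eq_pack => a y _ _.
  rewrite /low !mul0n expn0 !muln1 mul1n addn1 -[a.+2]addn2 -!expnM -expnD.
  by rewrite (_ : n * 2 + n * n + n * a = n * (a + 2 + n)); lia.
apply: definableD; first apply: definableD.
- apply: definable_pack_exp2 => //; last exact: definable_const.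
  apply/definable_exp2/definableD; last exact: definableM.
  by apply: definableM => //; apply: definable_const.
- by apply: definable_pack_mul_exp2; apply: definable_const.
- apply: definable_pack_exp2; try exact: definable_const.
  apply: definableD; last exact: definable_const.
  by apply/definable_exp2/definableD => //; apply: definable_const.
Qed.

(** Since [low] stays below [high] digit by digit, truncated subtraction commutes with packing. *)
Lemma definable_pack_digit d : d <= 1 ->
  definable (fun n => pack n (fun a y => high n a y - low d n a y)).
Proof.
move=> d1; apply: (@eq_definable (fun n => pack n (high n) - pack n (low d n))).
  move=> n _; apply/eqP; rewrite -(eqn_add2r (pack n (low d n))) -packD.
  have -> : pack n (fun a y => high n a y - low d n a y + low d n a y)
      = pack n (high n).
    by apply: eq_pack => a y an yY; rewrite subnK ?low_le_high.
  rewrite subnK //; apply: leq_sum => a _; rewrite leq_mul2l.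
  by apply/orP; right; apply: leq_sum => y _; rewrite leq_mul2l low_le_high ?orbT.
by apply: definableB; [apply: definable_pack_high | apply: definable_pack_low].
Qed.

(** * The least prime factor and the greatest non-trivial divisor *)

Lemma definable_pdiv : definable pdiv.
Proof.
pose M n := pack n (fun _ _ => 2 ^ flag n).
pose X d n := pack n (fun a y => high n a y - low d n a y).
pose V d n := logn 2 'C(X d n + M n, M n).
pose W n := V 0 n - V 1 n.
have WE n : 1 < n -> exists m, W n = (2 ^ n) ^ pdiv n * (1 + 2 ^ n * m).
  move=> n1; have q1 : 1 < 2 ^ n by rewrite -(expn0 2) ltn_exp2l // ltnW.
  have [|m Em] := @sum_weight_pdiv (2 ^ n) n (range n) q1 n1.
    by rewrite -expnM.
  exists m; rewrite -Em /W; apply/eqP.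
  (* [V 0] collects the weights where [<=] holds, [V 1] those where [<] holds; equality is what
     remains. *)
  have -> : V 0 n = \sum_(a < n) \sum_(y < range n)
      (if (2 ^ n) ^ a.+2 * (y + 2) == (2 ^ n) ^ (a.+2 + n) + 1 + y
       then y.+1 else 0) + V 1 n; last by rewrite addnK.
  rewrite /V /X /M !logn2_bin_pack // -big_split; apply: eq_bigr => a _ /=.
  rewrite -big_split; apply: eq_bigr => y _ /=.
  rewrite addn0 [_ + y + 1]addn1.
  by case: (ltngtP ((2 ^ n) ^ (a.+2 + n) + 1 + y) (_ * (y + 2))) => _;
    rewrite ?addn0.
have dM : definable M by apply: definable_pack_mask.
have dV d : d <= 1 -> definable (V d).
  move=> d1; apply: definable_logn2 => [|n _]; last by rewrite bin_gt0 leq_addl.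
  by apply: definable_bin => //; apply: definableD => //; apply: definable_pack_digit.
have W0 n : 1 < n -> 0 < W n.
  by move=> n1; have [m ->] := WE n n1; rewrite muln_gt0 !expn_gt0.
have dW : definable W by apply: definableB; apply: dV.
apply: (@eq_definable (fun n => logn 2 (W n) %/ n)).
  move=> n n1; have [m ->] := WE n n1.
  rewrite -expnM lognM ?expn_gt0 // pfactorK // [logn 2 (1 + _)]lognE dvdn2.
  (* The cofactor [1 + 2 ^ n * m] is odd because [n] is nonzero. *)
  rewrite oddD oddM oddX /= (_ : n == 0 = false) ?andbF //=; last by lia.
  by rewrite addn0 mulKn // ltnW.
by apply: definable_div; [apply: definable_logn2 | apply: definable_id].
Qed.

(** If [n = k * e] with [e < n], then [k > 1], so [pdiv n <= k] and [e * pdiv n <= n]. *)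
Lemma pdiv_codivisor n :
  composite n -> greatest_nontrivial_divisor (n %/ pdiv n) n.
Proof.
move=> /andP[n1 npr]; have p1 : 1 < pdiv n by rewrite prime_gt1 ?pdiv_prime.
have pn : pdiv n < n.
  rewrite ltn_neqAle pdiv_leq ?(ltnW n1) // andbT.
  by apply: contra npr => /eqP <-; apply: pdiv_prime.
have en : n %/ pdiv n * pdiv n = n by rewrite divnK ?pdiv_dvd.
split.
  apply/andP; split; last by apply/andP; split; nia.
  by apply/dvdnP; exists (pdiv n); rewrite mulnC en.
move=> e /andP[/dvdnP[k ek] /andP[e1 en']].
rewrite leq_divRL ?(ltnW p1) // {2}ek mulnC leq_mul2r.
have k1 : 1 < k by nia.
by rewrite pdiv_min_dvd ?orbT //; apply/dvdnP; exists e; rewrite mulnC.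
Qed.

Theorem corollary3p1 :
  exists T2 : arith_term 1,
    (forall n : nat, composite n -> greatest_nontrivial_divisor (aeval1 T2 n) n) /\
    (forall p : nat, prime p -> aeval1 T2 p = 1).
Proof.
have [T2 T2E] : definable (fun n => n %/ pdiv n).
  by apply: definable_div; [apply: definable_id | apply: definable_pdiv].
exists T2; split=> [n comp_n | p p_pr].
  by have /andP[n1 _] := comp_n; rewrite T2E //; apply: pdiv_codivisor.
by rewrite T2E ?prime_gt1 // pdiv_id // divnn prime_gt0.
Qed.
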